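(* Let $\psi^{(A)}$ and $\psi^{(B)}$ be neighbor functions and let $\sigma^{(A)},\sigma^{(B)}$ be positive numbers. Then $\psi^{(A)}$ and $\psi^{(B)}$ are continuously differentiable almost everywhere. Set $\sigma^*=1$ and define $\psi^*$ by $$\frac{d\psi^*(x)}{dx}=\min\left(\frac{1}{\sigma^{(A)}}\frac{d\psi^{(A)}(x)}{dx},\ \frac{1}{\sigma^{(B)}}\frac{d\psi^{(B)}(x)}{dx}\right),\qquad \psi^*(x)=\int_0^x\frac{d\psi^*(s)}{ds}\,ds.$$ Then $\psi^*$ is a neighbor function, and for every $x\geq 0$ we have $I_{\psi^{(A)},\sigma^{(A)}}(x)\subseteq I_{\psi^*,\sigma^*}(x)$ and $I_{\psi^{(B)},\sigma^{(B)}}(x)\subseteq I_{\psi^*,\sigma^*}(x)$.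
   Context: A neighbor function is a function $\psi:\mathbb{R}_{\geq 0}\to\mathbb{R}$ that is (i) strictly increasing, (ii) continuous, (iii) concave, and (iv) such that $g(x)=\psi(e^{x})$ is convex as a function of $x\in\mathbb{R}$. For a neighbor function $\psi$, a number $\sigma\geq 0$ and $y\geq 0$, the uncertainty interval around $y$ is $I_{\psi,\sigma}(y)=\big[\psi^{-1}(\max(\psi(0),\psi(y)-\sigma)),\ \psi^{-1}(\psi(y)+\sigma)\big]$. *)

(* Defs.v *)
From HB Require Import structures.
From mathcomp Require Import all_boot all_order all_algebra.
From mathcomp Require Import all_classical all_reals all_analysis.
Set Implicit Arguments. Unset Strict Implicit. Unset Printing Implicit Defensive.
Import Order.TTheory GRing.Theory Num.Theory.
Import numFieldNormedType.Exports.
Local Open Scope classical_set_scope.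
Local Open Scope ring_scope.

Section Neighbor.
Variable R : realType.

(* psi : R_{>=0} -> R is modelled as psi : R -> R; only values on [0,+oo)
   are constrained/used. *)
Definition neighbor_fun (psi : R -> R) : Prop :=
  (forall x y : R, 0 <= x -> x < y -> psi x < psi y) /\
  {within `[0, +oo[, continuous psi} /\
  (forall x y t : R, 0 <= x -> 0 <= y -> 0 <= t -> t <= 1 ->
     (1 - t) * psi x + t * psi y <= psi ((1 - t) * x + t * y)) /\
  (forall x y t : R, 0 <= t -> t <= 1 ->
     psi (expR ((1 - t) * x + t * y)) <= (1 - t) * psi (expR x) + t * psi (expR y)).

(* the inverse of psi on [0,+oo) (well defined on the range of psi) *)
Definition neighbor_inv (psi : R -> R) (v : R) : R :=
  xget 0 [set z : R | 0 <= z /\ psi z = v].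

Definition uncertainty_interval (psi : R -> R) (sigma y : R) : set R :=
  `[neighbor_inv psi (Num.max (psi 0) (psi y - sigma)),
    neighbor_inv psi (psi y + sigma)].

Definition ae_C1 (psi : R -> R) : Prop :=
  exists N : set R, (@lebesgue_measure R).-negligible N /\
    (forall x : R, 0 < x -> ~ N x -> derivable psi x 1) /\
    {within [set x : R | 0 < x] `\` N, continuous derive1 psi}.

Definition psi_star (psiA psiB : R -> R) (sigmaA sigmaB : R) (x : R) : R :=
  Rintegral (@lebesgue_measure R) `[0, x]
    (fun s => Num.min (derive1 psiA s / sigmaA) (derive1 psiB s / sigmaB)).

End Neighbor.

(* Main.v *)
Require Import Defs.
From HB Require Import structures.
From mathcomp Require Import all_boot all_order all_algebra.
From mathcomp Require Import all_classical all_reals all_analysis.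
From mathcomp Require Import measurable_realfun ring lra.
Import Order.TTheory GRing.Theory Num.Theory.
Import numFieldNormedType.Exports.
Local Open Scope classical_set_scope.
Local Open Scope ring_scope.

(** At a point x > 0, concavity of psi makes the left slope at least the right
    slope, while convexity of psi(e^u) gives the reverse inequality. Hence psi
    is differentiable at every x > 0, with
      psi'(x) x (ln y - ln x) <= psi y - psi x <= psi'(x) (y - x),
    and neighbor functions are exactly the functions, continuous on [0, +oo[,
    whose derivative on ]0, +oo[ is positive and nonincreasing with x psi'(x)
    nondecreasing. These conditions force psi' to be continuous, and they pass
    to positive multiples and to minima, so the integral of the minimum of two
    such slopes is again a neighbor function (psi' may blow up at 0, but it is
    integrable there because psi is continuous at 0). The increments of psi^*
    are dominated by those of psi / sigma, which gives the inclusions of the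
    uncertainty intervals; their endpoints are genuine preimages because the
    logarithmic lower bound makes every neighbor function unbounded. *)

Section NeighborFunctions.
Context {R : realType}.
Implicit Types (psi phi f g : R -> R) (a b c w x y z v : R).
Local Notation mu := (@lebesgue_measure R).

(** * Bounds for the logarithm and chord inequalities *)

Lemma ln_increment_le x y : 0 < x -> 0 < y -> ln y - ln x <= (y - x) / x.
Proof.
move=> x0 y0; rewrite -ln_div ?posrE//.
have -> : y / x = 1 + (y - x) / x by field; rewrite gt_eqF.
apply: le_ln1Dx; rewrite ltr_pdivlMr//; lra.
Qed.

Lemma ln_increment_ge x y : 0 < x -> 0 < y -> (y - x) / y <= ln y - ln x.
Proof.
move=> x0 y0; have := ln_increment_le _ _ y0 x0.
rewrite -(opprB y x) mulNr; lra.
Qed.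

(** Concavity at [b], the point of parameter [(b - a) / (c - a)] between [a] and [c], with the
    slopes cross-multiplied. *)
Lemma concave_chord psi : neighbor_fun psi -> forall a b c,
  0 <= a -> a < b -> b < c ->
  (psi c - psi b) * (b - a) <= (psi b - psi a) * (c - b).
Proof.
move=> [_ [_ [conc _]]] a b c a0 ab bc.
have ca : 0 < c - a by lra.
have t1 : (b - a) / (c - a) <= 1 by rewrite ler_pdivrMr//; lra.
have t0 : 0 <= (b - a) / (c - a) by rewrite divr_ge0//; lra.
have c0 : 0 <= c by lra.
have := conc a c _ a0 c0 t0 t1.
have -> : (1 - (b - a) / (c - a)) * a + (b - a) / (c - a) * c = b.
  by field; rewrite gt_eqF.
have -> : (1 - (b - a) / (c - a)) * psi a + (b - a) / (c - a) * psi c =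
    ((c - b) * psi a + (b - a) * psi c) / (c - a) by field; rewrite gt_eqF.
rewrite ler_pdivrMr//; lra.
Qed.

(** The same computation in the variable [ln], hence for positive [a]. *)
Lemma expR_convex_chord psi : neighbor_fun psi -> forall a b c,
  0 < a -> a < b -> b < c ->
  (psi b - psi a) * (ln c - ln b) <= (psi c - psi b) * (ln b - ln a).
Proof.
move=> [_ [_ [_ conv]]] a b c a0 ab bc.
have b0 : 0 < b by lra.
have c0 : 0 < c by lra.
have lab : ln a < ln b by rewrite ltr_ln ?posrE.
have lbc : ln b < ln c by rewrite ltr_ln ?posrE.
set la := ln a in lab *; set lb := ln b in lab lbc *; set lc := ln c in lbc *.
have ca : 0 < lc - la by lra.
have t1 : (lb - la) / (lc - la) <= 1 by rewrite ler_pdivrMr//; lra.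
have t0 : 0 <= (lb - la) / (lc - la) by rewrite divr_ge0//; lra.
have := conv la lc _ t0 t1.
have -> : (1 - (lb - la) / (lc - la)) * la + (lb - la) / (lc - la) * lc = lb.
  by field; rewrite gt_eqF.
rewrite !lnK ?posrE//.
have -> : (1 - (lb - la) / (lc - la)) * psi a + (lb - la) / (lc - la) * psi c =
    ((lc - lb) * psi a + (lb - la) * psi c) / (lc - la).
  by field; rewrite gt_eqF.
rewrite ler_pdivlMr//; lra.
Qed.

(** The slope [d] is the supremum of the right slopes at [x], finite because every left slope bounds
    them. Concavity gives the upper bound; the lower one rests on convexity of [psi (expR u)]. *)
Lemma neighbor_fun_tangent psi : neighbor_fun psi -> forall x, 0 < x ->
  exists2 d, 0 < d & forall y, 0 < y ->
    d * x * (ln y - ln x) <= psi y - psi x <= d * (y - x).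
Proof.
move=> npsi x x0; have incr := npsi.1.
pose E : set R := [set (psi y - psi x) / (y - x) | y in [set y | x < y]].
have E1 : E (psi (x + 1) - psi x).
  exists (x + 1); first by rewrite /=; lra.
  by rewrite addrAC subrr add0r divr1.
have ubw w : 0 <= w -> w < x -> ubound E ((psi x - psi w) / (x - w)).
  move=> w0 wx _ [y /= xy <-].
  rewrite ler_pdivrMr ?subr_gt0// mulrAC ler_pdivlMr ?subr_gt0//.
  exact: concave_chord.
have supE : has_sup E.
  split; first by exists (psi (x + 1) - psi x).
  by exists ((psi x - psi 0) / (x - 0)); exact: ubw.
pose d := sup E.
have dP y : x < y -> (psi y - psi x) <= d * (y - x).
  move=> xy; rewrite -ler_pdivrMr ?subr_gt0//.
  by apply: sup_ubound; [exact: supE.2|exists y].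
have d0 : 0 < d.
  have /dP : x < x + 1 by lra.
  have : psi x < psi (x + 1) by apply: incr; lra.
  lra.
exists d => // y y0; apply/andP; split; last first.
  have [xy|yx|->] := ltgtP x y; [exact: dP| |by rewrite !subrr mulr0].
  have : d <= (psi x - psi y) / (x - y).
    by apply: sup_le_ub; [exact: supE.1|apply: ubw => //; exact: ltW].
  rewrite ler_pdivlMr ?subr_gt0//; lra.
have [xy|yx|->] := ltgtP x y; last by rewrite !subrr mulr0.
- have lxy : 0 < ln y - ln x by rewrite subr_gt0 ltr_ln ?posrE.
  have pxy : psi x < psi y by apply: incr => //; exact: ltW.
  suff : d <= (psi y - psi x) / (x * (ln y - ln x)).
    by rewrite ler_pdivlMr ?mulr_gt0// mulrA.
  (* Convexity in [ln] compares the logarithmic slopes from [x] to [z] and from [x] to [y]; then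
     [x * (ln z - ln x) <= z - x]. *)
  have Hxy z : x < z -> z <= y ->
      (psi z - psi x) * (x * (ln y - ln x)) <= (psi y - psi x) * (z - x).
    move=> xz zy; have z0 : 0 < z by lra.
    have lzx := ln_increment_le _ _ x0 z0; rewrite ler_pdivlMr// in lzx.
    apply: (@le_trans _ _ ((psi y - psi x) * (x * (ln z - ln x)))).
      have [zy'|yz|->//] := ltgtP z y; last lra.
      have := expR_convex_chord _ npsi _ _ _ x0 xz zy'.
      nra.
    by rewrite ler_pM2l ?subr_gt0//; lra.
  apply: sup_le_ub; first exact: supE.1.
  move=> _ [z /= xz <-].
  rewrite ler_pdivrMr ?subr_gt0// mulrAC ler_pdivlMr ?mulr_gt0//.
  have [zy|yz] := leP z y; first exact: Hxy.
  (* Beyond [y] the slope from [x] is no greater, by concavity, which reduces to the case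
     [z = y]. *)
  apply: (@le_trans _ _
      ((psi y - psi x) / (y - x) * (z - x) * (x * (ln y - ln x)))).
    rewrite ler_pM2r ?mulr_gt0// mulrAC ler_pdivlMr ?subr_gt0//.
    have := concave_chord _ npsi _ _ _ (ltW x0) xy yz; lra.
  rewrite mulrAC ler_pM2r ?subr_gt0//.
  rewrite mulrAC ler_pdivrMr ?subr_gt0//; exact: Hxy.
- have lyx : 0 < ln x - ln y by rewrite subr_gt0 ltr_ln ?posrE.
  suff : (psi x - psi y) / (ln x - ln y) <= d * x.
    rewrite ler_pdivrMr//; lra.
  (* The logarithmic slope on [[y, x]] is at most that on [[x, z]], hence at most [d * z]; then [z]
     decreases to [x]. *)
  suff H z : x < z -> (psi x - psi y) / (ln x - ln y) <= d * z.
    apply/ler_addgt0Pr => e e0.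
    have -> : d * x + e = d * (x + e / d) by field; rewrite gt_eqF.
    by apply: H; rewrite ltrDl divr_gt0.
  move=> xz; have z0 : 0 < z by lra.
  rewrite ler_pdivrMr//.
  have lxz : 0 < ln z - ln x by rewrite subr_gt0 ltr_ln ?posrE.
  rewrite -(ler_pM2r lxz).
  apply: le_trans (expR_convex_chord _ npsi _ _ _ y0 yx xz) _.
  rewrite mulrAC ler_pM2r//; apply: (le_trans (dP _ xz)).
  rewrite -mulrA ler_pM2l// mulrC -ler_pdivrMr//; exact: ln_increment_ge.
Qed.

(** * Differentiability by squeezing *)

Lemma cvg_dist_le (T : Type) (F : set_system T) {FF : Filter F}
    (u g : T -> R) (l : R) :
  (\forall t \near F, `|l - g t| <= `|l - u t|) -> u @ F --> l -> g @ F --> l.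
Proof.
move=> gu /cvgrPdist_le ul; apply/cvgrPdist_le => e e0.
by near=> t; apply: (@le_trans _ _ `|l - u t|); near: t; [exact: gu|exact: ul].
Unshelve. all: by end_near. Qed.

(** The difference quotient lies between [d] and [d * x / (h + x)]. The order of these two depends
    on the sign of [h], but the quotient is always the closer to [d]. *)
Lemma is_derive_squeeze psi x (d : R) : 0 < x -> 0 < d ->
  (forall y, 0 < y -> d * x * ((y - x) / y) <= psi y - psi x <= d * (y - x)) ->
  is_derive x 1 psi d.
Proof.
move=> x0 d0 sq.
have quot_cvg : h^-1 *: (psi (h *: 1 + x) - psi x) @[h --> 0^'] --> d.
  apply: (@cvg_dist_le _ _ _ (fun h => d * x / (h + x))); last first.
    rewrite -[X in _ --> X](_ : d * x / (0 + x) = d); last first.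
      by rewrite add0r mulfK// gt_eqF.
    apply: cvg_within_filter.
    apply: cvgM; first exact: cvg_cst.
    apply: cvgV; first by rewrite add0r gt_eqF.
    by apply: cvgD; [exact: cvg_id|exact: cvg_cst].
  have hx : \forall h \near 0^', 0 < h + x.
    near=> h; rewrite addrC -ltrBlDl sub0r; apply: ltrNnormlW.
    near: h; exact: dnbhs0_lt.
  near=> h.
  have h0 : h != 0 by near: h; exact: nbhs_dnbhs_neq.
  have y0 : 0 < h + x by near: h.
  rewrite [h *: 1]mulr1.
  have /andP[] := sq _ y0; rewrite addrK.
  set P := psi _ - psi x => lo up.
  have {}lo : d * x / (h + x) * h <= P.
    by apply: le_trans lo; rewrite -!mulrA [_^-1 * h]mulrC.
  have -> : h^-1 *: P = P / h by rewrite mulrC.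
  have [hp|hn] := ltP 0 h.
    have {}lo : d * x / (h + x) <= P / h by rewrite ler_pdivlMr.
    have {}up : P / h <= d by rewrite ler_pdivrMr.
    rewrite !ger0_norm; lra.
  have {}hn : h < 0 by rewrite lt_neqAle h0.
  have {}lo : P / h <= d * x / (h + x) by rewrite ler_ndivrMr.
  have {}up : d <= P / h by rewrite ler_ndivlMr.
  rewrite !ler0_norm; lra.
apply: DeriveDef; first by apply/cvg_ex; exists d.
by apply/cvg_lim.
Unshelve. all: by end_near. Qed.

(** * Slope conditions on the derivative *)

(* What a neighbor function's derivative satisfies: psi' nonincreasing is
   concavity, and x psi'(x), the derivative of psi(e^u) at u = ln x,
   nondecreasing is convexity of psi(e^u). *)
Definition neighbor_slope f :=
  (forall x, 0 < x -> 0 < f x) /\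
  (forall x y, 0 < x -> x <= y -> f y <= f x /\ x * f x <= y * f y).

Lemma neighbor_fun_is_derive psi : neighbor_fun psi -> forall x, 0 < x ->
  [/\ derivable psi x 1, 0 < derive1 psi x & forall y, 0 < y ->
    derive1 psi x * x * (ln y - ln x) <= psi y - psi x
      <= derive1 psi x * (y - x)].
Proof.
move=> npsi x x0; have [d d0 dP] := neighbor_fun_tangent _ npsi _ x0.
have dpsi : is_derive x 1 psi d.
  apply: is_derive_squeeze => // y y0; have /andP[lo ->] := dP y y0.
  rewrite andbT; apply: le_trans lo.
  by rewrite ler_pM2l ?mulr_gt0//; exact: ln_increment_ge.
by rewrite derive1E derive_val; split.
Qed.

(** Adding the bounds based at [x] and at [y]: the upper ones give monotonicity of the derivative,
    the lower ones that of its product with the variable. *)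
Lemma neighbor_fun_slope psi : neighbor_fun psi -> neighbor_slope (derive1 psi).
Proof.
move=> npsi; split=> [x x0|x y x0 xy].
  by have [] := neighbor_fun_is_derive _ npsi _ x0.
have y0 : 0 < y by lra.
move: xy; rewrite le_eqVlt => /predU1P[->//|xy].
have [_ _ /(_ _ y0)/andP[lx ux]] := neighbor_fun_is_derive _ npsi _ x0.
have [_ _ /(_ _ x0)/andP[ly uy]] := neighbor_fun_is_derive _ npsi _ y0.
split.
  have : 0 < y - x by lra.
  nra.
have : 0 < ln y - ln x by rewrite subr_gt0 ltr_ln ?posrE.
nra.
Qed.

(** The two monotonicities trap [f y] between [f x] and [f x * x / y], on either side of [x]. *)
Lemma neighbor_slope_continuous f : neighbor_slope f ->
  forall x, 0 < x -> {for x, continuous f}.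
Proof.
move=> [f0 fP] x x0; apply: (@cvg_dist_le _ _ _ (fun y => f x * x / y)).
  near=> y; have y0 : 0 < y by near: y; exact: lt_nbhsr.
  have [xy|yx] := leP x y.
    have [le1 le2] := fP _ _ x0 xy.
    have : f x * x / y <= f y by rewrite ler_pdivrMr//; lra.
    by move=> ?; rewrite !ger0_norm; lra.
  have [le1 le2] := fP _ _ y0 (ltW yx).
  have : f y <= f x * x / y by rewrite ler_pdivlMr//; lra.
  by move=> ?; rewrite !ler0_norm; lra.
rewrite -[X in _ --> X](_ : f x * x / x = f x); last by rewrite mulfK// gt_eqF.
apply: cvgM; first exact: cvg_cst.
by apply: cvgV; [rewrite gt_eqF|exact: cvg_id].
Unshelve. all: by end_near. Qed.

Lemma neighbor_slope_div f (k : R) : 0 < k ->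
  neighbor_slope f -> neighbor_slope (fun x => f x / k).
Proof.
move=> k0 [f0 fP]; split=> [x x0|x y x0 xy]; first by rewrite divr_gt0// f0.
have [le1 le2] := fP _ _ x0 xy.
by rewrite !mulrA !ler_pM2r ?invr_gt0.
Qed.

Lemma neighbor_slope_min f g : neighbor_slope f -> neighbor_slope g ->
  neighbor_slope (fun x => Num.min (f x) (g x)).
Proof.
move=> [f0 fP] [g0 gP]; split=> [x x0|x y x0 xy].
  by rewrite lt_min f0//= g0.
have [f1 f2] := fP _ _ x0 xy; have [g1 g2] := gP _ _ x0 xy.
have y0 : 0 < y by lra.
rewrite !minr_pMr ?(ltW x0) ?(ltW y0)//.
by split; rewrite le_min !ge_min ?f1 ?f2 ?g1 ?g2 ?orbT.
Qed.

Lemma eq_neighbor_slope f g : (forall x, 0 < x -> f x = g x) ->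
  neighbor_slope f -> neighbor_slope g.
Proof.
move=> fg [f0 fP]; split=> [x x0|x y x0 xy]; first by rewrite -fg// f0.
by rewrite -!fg//; [exact: fP|lra].
Qed.

(** * From slope conditions back to neighbor functions *)

Lemma derivable_increment_le psi phi (a b : R) : a <= b ->
  {within `[a, b], continuous psi} -> {within `[a, b], continuous phi} ->
  (forall x, x \in `]a, b[ -> derivable psi x 1) ->
  (forall x, x \in `]a, b[ -> derivable phi x 1) ->
  (forall x, x \in `]a, b[ -> derive1 phi x <= derive1 psi x) ->
  phi b - phi a <= psi b - psi a.
Proof.
move=> ab cpsi cphi dpsi dphi le_d.
have H : {in `[a, b]%R &, {homo (psi - phi) : x y / x <= y}}.
  apply: ger0_derive1_le_cc => [x xab|x xab|].
  - by apply: derivableB; [exact: dpsi|exact: dphi].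
  - rewrite derive1E deriveB; [|exact: dpsi|exact: dphi].
    by rewrite -!derive1E subr_ge0 le_d.
  - exact: within_continuousB.
have := H a b; rewrite !in_itv/= !lexx ab => /(_ isT isT isT).
rewrite !fctE; lra.
Qed.

Lemma within_itvcy_itvcc psi a b : 0 <= a ->
  {within `[0, +oo[, continuous psi} -> {within `[a, b], continuous psi}.
Proof.
move=> a0; apply: continuous_subspaceW => z /=; rewrite !in_itv/= andbT.
by move=> /andP[az _]; exact: le_trans az.
Qed.

(** The slope conditions put a tangent above [psi] ([tan]) and, in the variable [ln], a tangent
    below it ([ltan]). Averaging the tangent inequalities at the intermediate point gives concavity
    and convexity. *)
Lemma neighbor_slope_fun psi : {within `[0, +oo[, continuous psi} ->
  (forall x, 0 < x -> derivable psi x 1) -> neighbor_slope (derive1 psi) ->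
  neighbor_fun psi.
Proof.
move=> cpsi dpsi [f0 fP].
have cab a b (a0 : 0 <= a) := within_itvcy_itvcc psi a b a0 cpsi.
have dab a b : 0 <= a -> forall z, z \in `]a, b[ -> derivable psi z 1.
  by move=> a0 z; rewrite in_itv/= => /andP[az _]; apply: dpsi; lra.
have tan z y : 0 < z -> 0 <= y -> psi y - psi z <= derive1 psi z * (y - z).
  move=> z0 y0.
  have mvt a b : 0 <= a -> a < b ->
      exists2 c, a < c < b & psi b - psi a = derive1 psi c * (b - a).
    move=> a0 ab.
    have [w wab|c] := @MVT _ psi (derive1 psi) a b ab _ (cab _ _ a0).
      by rewrite derive1E; exact/derivableP/(dab a b).
    by rewrite in_itv/=; exists c.
  have [zy|yz|->] := ltgtP z y; last by rewrite !subrr mulr0.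
    have [c /andP[zc cy] ->] := mvt _ _ (ltW z0) zy.
    by rewrite ler_pM2r ?subr_gt0//; exact: (fP _ _ z0 (ltW zc)).1.
  have [c /andP[yc cz] E] := mvt _ _ y0 yz.
  have c0 : 0 < c by lra.
  have [le1 _] := fP _ _ c0 (ltW cz).
  rewrite -opprB E -(opprB z) mulrN lerN2.
  by rewrite ler_pM2r ?subr_gt0.
(* Compare with [k *: ln], whose derivative [k / w] equals that of [psi] at [w = z]. *)
have ltan z y : 0 < z -> 0 < y ->
    derive1 psi z * z * (ln y - ln z) <= psi y - psi z.
  move=> z0 y0; pose k := derive1 psi z * z.
  have dln w : 0 < w -> is_derive w 1 (k *: @ln R) (k / w).
    by move=> w0; apply: is_deriveZ; exact: is_derive1_ln.
  have dkln w : 0 < w -> derive1 (k *: @ln R) w = k / w.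
    by move=> w0; have := dln _ w0; rewrite derive1E => /@derive_val.
  have ckln a b : 0 < a -> {within `[a, b], continuous (k *: @ln R)}.
    move=> a0; apply: derivable_within_continuous => w.
    rewrite in_itv/= => /andP[aw _].
    have /dln/@ex_derive // : 0 < w by lra.
  have [zy|yz|->] := ltgtP z y; last by rewrite !subrr mulr0.
    suff : k * ln y - k * ln z <= psi y - psi z by rewrite mulrBr.
    apply: (@derivable_increment_le psi (k *: @ln R)) (ltW zy)
      (cab _ _ (ltW z0)) (ckln _ _ z0) (dab _ _ (ltW z0)) _ _ => w;
      rewrite in_itv/= => /andP[zw _]; have w0 : 0 < w by lra.
      by have /@ex_derive := dln _ w0.
    rewrite dkln// ler_pdivrMr//; have := fP _ _ z0 (ltW zw); rewrite /k; lra.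
  suff : psi z - psi y <= k * ln z - k * ln y by rewrite /k; lra.
  apply: (@derivable_increment_le (k *: @ln R) psi) (ltW yz)
    (ckln _ _ y0) (cab _ _ (ltW y0)) _ (dab _ _ (ltW y0)) _ => w;
    rewrite in_itv/= => /andP[yw wz]; have w0 : 0 < w by lra.
    by have /@ex_derive := dln _ w0.
  rewrite dkln// ler_pdivlMr//; have := fP _ _ w0 (ltW wz); rewrite /k; lra.
split; last split => //; last split.
- move=> x y x0 xy.
  have dxy z : z \in `]x, y[ -> is_derive z 1 psi (derive1 psi z).
    by move=> zxy; rewrite derive1E; exact/derivableP/(dab x y).
  have [z] := MVT xy dxy (cab _ _ x0).
  rewrite in_itv/= => /andP[xz zy] E.
  rewrite -subr_gt0 E mulr_gt0 ?subr_gt0// f0//; lra.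
- move=> x y t x0 y0 t0 t1.
  set z := (1 - t) * x + t * y.
  have [z0|] := ltP 0 z.
    have := tan z x z0 x0; have := tan z y z0 y0; rewrite {}/z in z0 *; nra.
  (* No tangent is available at 0, but a zero combination forces [t = 1], [t = 0] or [x = y = 0]. *)
  rewrite /z => z0.
  have tx : (1 - t) * x = 0 by nra.
  have ty : t * y = 0 by nra.
  move/eqP : tx; rewrite mulf_eq0 subr_eq0 => /orP[/eqP t1'|/eqP x0'].
    by move: ty; rewrite -t1' mul1r => ->; rewrite subrr !mul0r !add0r !mul1r.
  move/eqP : ty; rewrite mulf_eq0 => /orP[/eqP ->|/eqP y0'].
    by rewrite subr0 !mul0r !mul1r !addr0.
  by rewrite x0' y0' !mulr0 addr0 -mulrDl subrK mul1r.
- move=> x y t t0 t1; set z := (1 - t) * x + t * y.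
  have ez := expR_gt0 z.
  have := ltan _ _ ez (expR_gt0 x); have := ltan _ _ ez (expR_gt0 y).
  rewrite !expRK; set c := _ * expR z.
  have zE : z = (1 - t) * x + t * y by [].
  move: z zE c ez => z -> c _; nra.
Qed.

(** * Inverses and uncertainty intervals *)

Lemma neighbor_fun_le psi : neighbor_fun psi -> forall x y,
  0 <= x -> 0 <= y -> (psi x <= psi y) = (x <= y).
Proof.
move=> [incr _] x y x0 y0; have [xy|yx|->] := ltgtP x y; last by rewrite lexx.
  by rewrite ltW// incr.
by apply/negbTE; rewrite -ltNge incr.
Qed.

Lemma neighbor_fun_surj psi v : neighbor_fun psi -> psi 0 <= v ->
  exists z, 0 <= z /\ psi z = v.
Proof.
move=> npsi v0.
have [_ d1 tan] := neighbor_fun_is_derive _ npsi _ (@ltr01 R).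
(* At this [b] the logarithmic lower bound based at 1 takes the value [v]. *)
pose b := expR ((v - psi 1) / derive1 psi 1).
have vb : v <= psi b.
  have /andP[+ _] := tan _ (expR_gt0 ((v - psi 1) / derive1 psi 1)).
  rewrite expRK ln1 subr0 mulr1 mulrCA divff ?gt_eqF// mulr1 -/b; lra.
have b0 : 0 <= b by exact: expR_ge0.
have [|z] := IVT b0 (within_itvcy_itvcc psi 0 b (lexx 0) npsi.2.1) (v := v).
  by rewrite ge_min v0/= le_max vb orbT.
by rewrite in_itv/= => /andP[z0 _] <-; exists z.
Qed.

(** A preimage exists, so [xget] does not fall back on its default. *)
Lemma neighbor_invP psi v : neighbor_fun psi -> psi 0 <= v ->
  0 <= neighbor_inv psi v /\ psi (neighbor_inv psi v) = v.
Proof.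
move=> npsi v0; have [z zP] := neighbor_fun_surj _ _ npsi v0.
exact: (@xgetPex _ 0 [set z | 0 <= z /\ psi z = v]) (ex_intro _ z zP).
Qed.

(** In units of its tolerance [phi] varies no faster than [psi], so it must move at least as far
    from [x] to change by one unit. Endpoints are compared through their images under the increasing
    [phi]. *)
Lemma uncertainty_interval_sub psi phi (sigma tau : R) x :
  neighbor_fun psi -> neighbor_fun phi -> 0 < sigma -> 0 < tau -> 0 <= x ->
  (forall a b, 0 <= a -> a <= b ->
     (phi b - phi a) / tau <= (psi b - psi a) / sigma) ->
  uncertainty_interval psi sigma x `<=` uncertainty_interval phi tau x.
Proof.
move=> npsi nphi s0 t0 x0 inc.
have px : psi 0 <= psi x by rewrite neighbor_fun_le.
have fx : phi 0 <= phi x by rewrite neighbor_fun_le.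
rewrite /uncertainty_interval.
have [||a0 aE] := @neighbor_invP psi (Num.max (psi 0) (psi x - sigma)) => //.
  by rewrite le_max lexx.
have [||b0 bE] := @neighbor_invP psi (psi x + sigma) => //; first lra.
have [||c0 cE] := @neighbor_invP phi (Num.max (phi 0) (phi x - tau)) => //.
  by rewrite le_max lexx.
have [||e0 eE] := @neighbor_invP phi (phi x + tau) => //; first lra.
apply: subset_itvScc; rewrite bnd_simp.
- rewrite -(neighbor_fun_le _ nphi)// cE ge_max neighbor_fun_le// a0/=.
  set a := neighbor_inv _ _ in a0 aE *.
  have ax : a <= x.
    by rewrite -(neighbor_fun_le _ npsi)// aE ge_max px; lra.
  have := inc _ _ a0 ax; rewrite ler_pdivrMr// => H.
  (* Truncation at [psi 0] can only shorten the drop, so it is at most [sigma]. *)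
  have : (psi x - psi a) / sigma * tau <= 1 * tau.
    rewrite ler_pM2r// ler_pdivrMr// mul1r.
    have : psi x - sigma <= psi a by rewrite aE le_max lexx orbT.
    lra.
  lra.
- rewrite -(neighbor_fun_le _ nphi)// eE.
  set b := neighbor_inv _ _ in b0 bE *.
  have xb : x <= b by rewrite -(neighbor_fun_le _ npsi)// bE; lra.
  have := inc _ _ x0 xb; rewrite ler_pdivrMr// bE.
  rewrite addrAC subrr add0r divff ?gt_eqF//; lra.
Qed.

(** * Regularity, integrability near 0 and integrals of slopes *)

Lemma neighbor_fun_ae_C1 psi : neighbor_fun psi -> ae_C1 psi.
Proof.
(* The derivative exists and is continuous at every positive point: the exceptional set is empty. *)
move=> npsi; exists set0; split; first exact: negligible_set0.
split=> [x x0 _|]; first by have [] := neighbor_fun_is_derive _ npsi _ x0.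
rewrite setD0; apply: continuous_in_subspaceT => x.
rewrite inE/= => x0; apply: neighbor_slope_continuous => //.
exact: neighbor_fun_slope.
Qed.

Lemma neighbor_slope_measurable f b : neighbor_slope f ->
  measurable_fun `]0, b] f.
Proof.
move=> fP; apply: subspace_continuous_measurable_fun => //.
apply: continuous_in_subspaceT => x; rewrite inE/= in_itv/= => /andP[x0 _].
exact: neighbor_slope_continuous.
Qed.

Lemma itv_oc_bigcup b :
  [set` `]0, b]] = \bigcup_n [set` `[n.+1%:R^-1, b]] :> set R.
Proof.
apply/seteqP; split=> x /=.
  rewrite in_itv/= => /andP[x0 xb].
  have [n nx] := ltr_add_invr x0.
  by exists n => //=; rewrite in_itv/= xb andbT ltW// -[ltLHS]add0r.
move=> [n _] /=; rewrite !in_itv/= => /andP[nx ->]; rewrite andbT.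
by apply: lt_le_trans nx; rewrite invr_gt0.
Qed.

(** On [[n.+1%:R^-1, b]], away from a possible blow-up at 0, the integral is an increment of [psi],
    at most [psi b - psi 0]; monotone convergence carries the bound to []0, b]]. *)
Lemma neighbor_fun_derive1_integrable psi b : neighbor_fun psi ->
  mu.-integrable `]0, b] (EFin \o derive1 psi).
Proof.
move=> npsi; have slope := neighbor_fun_slope _ npsi.
have mf := neighbor_slope_measurable _ b slope.
have ge0 x : 0 < x -> (0 <= (derive1 psi x)%:E)%E.
  by move=> x0; rewrite lee_fin ltW// slope.1.
apply/integrableP; split; first exact/measurable_EFinP.
(* The absolute value keeps the bound nonnegative also for negative [b]. *)
apply: (@le_lt_trans _ _ (`|psi b - psi 0|)%:E); last by rewrite ltry.
rewrite [leLHS](_ : _ =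
    \int[mu]_(x in `]0%R, b]) (EFin \o derive1 psi) x)%E; last first.
  apply: eq_integral => x; rewrite inE/= in_itv/= => /andP[x0 _].
  by rewrite /= ger0_norm// ltW// slope.1.
pose F n : set R := [set` `[n.+1%:R^-1, b]].
have F0 n x : F n x -> 0 < x.
  rewrite /F/= in_itv/= => /andP[nx _]; apply: lt_le_trans nx.
  by rewrite invr_gt0.
have cvgF : (\int[mu]_(x in F i) (EFin \o derive1 psi) x @[i --> \oo] -->
    \int[mu]_(x in \bigcup_i F i) (EFin \o derive1 psi) x)%E.
  apply: ge0_nondecreasing_set_cvg_integral.
  - apply/nondecreasing_seqP => n; rewrite subsetEset; apply: subset_itvr.
    by rewrite bnd_simp lef_pV2 ?posrE// ler_nat.
  - by move=> n; exact: measurable_itv.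
  - move=> n; apply/measurable_EFinP; apply: measurable_funS mf => // x Fx.
    by have := F0 _ _ Fx; move: Fx; rewrite /F/= !in_itv/= => /andP[_ ->] ->.
  - by move=> n x /F0 /ge0.
rewrite itv_oc_bigcup -(cvg_lim _ cvgF)//.
apply: lime_le; first by apply/cvg_ex; eexists; exact: cvgF.
apply: nearW => n.
have n0 : 0 < n.+1%:R^-1 :> R by rewrite invr_gt0.
have [nb|bn] := ltP (n.+1%:R^-1) b; last first.
  rewrite (_ : (\int[mu]_(x in F n) _)%E = 0%E) ?lee_fin//.
  move: bn; rewrite le_eqVlt => /predU1P[bE|bn].
    by rewrite /F bE set_itv1 integral_set1.
  by rewrite /F set_itv_ge ?integral_set0// bnd_simp -ltNge.
rewrite (continuous_FTC2 (F := psi) nb)//.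
- rewrite -EFinB lee_fin.
  apply: (@le_trans _ _ (psi b - psi 0)); last exact: ler_norm.
  rewrite lerD2l lerN2 neighbor_fun_le//; exact: ltW.
- apply: continuous_in_subspaceT => x; rewrite inE/= => /F0 x0.
  exact: neighbor_slope_continuous.
- have cpsi := within_itvcy_itvcc _ _ b (ltW n0) npsi.2.1.
  have /(continuous_within_itvP _ nb)[_ ? ?] := cpsi.
  split => // x; rewrite in_itv/= => /andP[nx _]; have x0 := lt_trans n0 nx.
  by have [] := neighbor_fun_is_derive _ npsi _ x0.
Qed.

Lemma neighbor_slope_le_integrable f psi (k b : R) : 0 < k ->
  neighbor_slope f -> neighbor_fun psi ->
  (forall x, 0 < x -> f x <= derive1 psi x / k) ->
  mu.-integrable `[0, b] (EFin \o f).
Proof.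
move=> k0 fP npsi le_f.
(* Nothing is known of [f] at 0, but one point affects neither measurability nor the integral. *)
suff : mu.-integrable `]0, b] (EFin \o f).
  move=> /integrableP[/emeasurable_fun_itv_obnd_cbndP mf intf].
  apply/integrableP; split=> //.
  rewrite -integral_itv_obnd_cbnd//; apply/emeasurable_fun_itv_obnd_cbndP.
  exact: measurableT_comp.
have intpsi := neighbor_fun_derive1_integrable _ b npsi.
apply: (le_integrable _ _ _ (integrableZl _ k^-1 intpsi)) => //.
  by apply/measurable_EFinP; exact: neighbor_slope_measurable.
move=> x /=; rewrite in_itv/= => /andP[x0 _]; rewrite lee_fin.
have fx := fP.1 _ x0; have := le_f _ x0.
by rewrite mulrC => le; rewrite !ger0_norm; lra.
Qed.

(** A slope is continuous on the positive axis, so its primitive has it as derivative there.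
    Domination by the derivative of [psi] makes it integrable up to 0. *)
Lemma neighbor_slope_integral f psi (k : R) : 0 < k ->
  neighbor_slope f -> neighbor_fun psi ->
  (forall x, 0 < x -> f x <= derive1 psi x / k) ->
  neighbor_fun (fun x => Rintegral mu `[0, x] f) /\
  forall x, 0 < x -> derive1 (fun x => Rintegral mu `[0, x] f) x = f x.
Proof.
move=> k0 fP npsi le_f.
have intf b := neighbor_slope_le_integrable _ _ _ b k0 fP npsi le_f.
have FTC x : 0 < x -> derivable (fun x => Rintegral mu `[0, x] f) x 1 /\
    derive1 (fun x => Rintegral mu `[0, x] f) x = f x.
  move=> x0; have xu : x < x + 1 by rewrite ltrDl.
  apply: (continuous_FTC1_closed xu) => //.
  exact: neighbor_slope_continuous.
split; last by move=> x /FTC[].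
apply: neighbor_slope_fun.
- apply/continuous_within_itvcyP; split=> [x|].
    rewrite in_itv/= andbT => x0.
    by apply/differentiable_continuous/derivable1_diffP; have [] := FTC _ x0.
  (* Right continuity at 0 follows from integrability on [[0, 1]]. *)
  have := parameterized_integral_continuous (@ler01 R) (intf 1).
  by move=> /(continuous_within_itvP _ (@ltr01 R))[].
- by move=> x /FTC[].
- by apply: eq_neighbor_slope fP => x /FTC[].
Qed.

(** * Comparison of normalised increments *)

Lemma neighbor_fun_increment_le psi phi (sigma tau : R) :
  neighbor_fun psi -> neighbor_fun phi -> 0 < sigma -> 0 < tau ->
  (forall x, 0 < x -> derive1 phi x / tau <= derive1 psi x / sigma) ->
  forall a b, 0 <= a -> a <= b ->
  (phi b - phi a) / tau <= (psi b - psi a) / sigma.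
Proof.
move=> npsi nphi s0 t0 le_d a b a0 ab.
have der h (k : R) : neighbor_fun h -> forall x, 0 < x ->
    is_derive x 1 (k *: h) (k * derive1 h x).
  move=> nh x x0; apply: is_deriveZ; rewrite derive1E; apply/derivableP.
  by have [] := neighbor_fun_is_derive _ nh _ x0.
have cont h (k : R) : neighbor_fun h -> {within `[a, b], continuous (k *: h)}.
  move=> nh x; apply: (@continuousZr _ _ (subspace `[a, b])).
  exact: within_itvcy_itvcc nh.2.1 _.
have pos x : x \in `]a, b[ -> 0 < x by rewrite in_itv/= => /andP[ax _]; lra.
rewrite ![_ / tau]mulrC ![_ / sigma]mulrC !mulrBr.
apply: (derivable_increment_le (sigma^-1 *: psi) (tau^-1 *: phi)) => //.
- exact: cont.
- exact: cont.
- by move=> x /pos x0; have /@ex_derive := der psi sigma^-1 npsi _ x0.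
- by move=> x /pos x0; have /@ex_derive := der phi tau^-1 nphi _ x0.
- move=> x /pos x0; rewrite !derive1E.
  have /@derive_val -> := der psi sigma^-1 npsi _ x0.
  have /@derive_val -> := der phi tau^-1 nphi _ x0.
  by rewrite ![_^-1 * _]mulrC le_d.
Qed.

End NeighborFunctions.

Theorem theorem5p7 (R : realType) (psiA psiB : R -> R) (sigmaA sigmaB : R) :
  neighbor_fun psiA -> neighbor_fun psiB -> 0 < sigmaA -> 0 < sigmaB ->
  ae_C1 psiA /\ ae_C1 psiB /\
  neighbor_fun (psi_star psiA psiB sigmaA sigmaB) /\
  (forall x : R, 0 <= x ->
     uncertainty_interval psiA sigmaA x
       `<=` uncertainty_interval (psi_star psiA psiB sigmaA sigmaB) 1 x /\
     uncertainty_interval psiB sigmaB x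
       `<=` uncertainty_interval (psi_star psiA psiB sigmaA sigmaB) 1 x).
Proof.
move=> nA nB sA sB.
split; first exact: neighbor_fun_ae_C1.
split; first exact: neighbor_fun_ae_C1.
have slopeA := neighbor_slope_div _ _ sA (neighbor_fun_slope _ nA).
have slopeB := neighbor_slope_div _ _ sB (neighbor_fun_slope _ nB).
have slope := neighbor_slope_min _ _ slopeA slopeB.
(* The integral of this minimum is [psi_star]; the slope of [psiA] serves as the dominating
   function. *)
have [|nS dS] := neighbor_slope_integral _ _ _ sA slope nA.
  by move=> x _; rewrite ge_min lexx.
split=> // x x0; split; apply: uncertainty_interval_sub => //;
  apply: neighbor_fun_increment_le => // z z0;
  by rewrite dS// divr1 ge_min lexx ?orbT.
Qed.
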